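(* Let $(\mathcal S,\mathcal A,P,R,\gamma)$ be a finite discounted MDP (cost-minimization convention) with $\mathcal S_d\neq\mathcal S$, let $h$ be a convex function as in the context, and let $\{\pi^{(k)}\}_{k\ge 0}\subset\Pi$ be a sequence generated by policy mirror descent with $\pi^{(0)}\in\mathrm{ri}(\Pi)$ and step sizes $\{\eta_k\}_{k\ge0}$, i.e. $$\pi_s^{(k+1)} \in \mathop{\arg\min}_{p \in \Delta(\mathcal A)} \left\{ \eta_k \langle Q_s(\pi^{(k)}), p\rangle + D(p, \pi_s^{(k)}) \right\},\qquad \forall s\in\mathcal S,\ k\ge 0.$$ Suppose the step sizes form a non-decreasing sequence with $\eta_k>0$ for all $k\ge 0$, and suppose that $$Q_{s,a}(\pi^{(k)}) - Q^*_{s,a} \le A_k,\qquad \forall s\in\mathcal S,\ a\in\mathcal A,\ k\ge 0,$$ where $\{A_k\}_{k\ge0}$ is a decreasing sequence of real numbers with $\lim_{k\to+\infty}A_k=0$. Then: 1. Suppose $\nabla h(p)$ is well-defined for all $p\in\Delta(\mathcal A)$, and let $M:=\sup_{a\in\mathcal A,\,p\in\Delta(\mathcal A)}|\nabla_a h(p)|$. If $K:=\inf\{k\in\mathbb N:\ \eta_k(\Delta-A_k)>4M\}<+\infty$, then for all $k\ge K$ and all $s\in\mathcal S$, $\pi_s^{(k+1)}\in\Pi_s^*$ and $V_s(\pi^{(k+1)})=V_s^*$. (That is, policy mirror descent with the Bregman divergence defined by $h$ can stop after finitely many iterations.) 2. Suppose that $\partial h(p)$ is not well-defined (i.e. $\partial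 h(p)=\emptyset$) for every $p$ in the relative boundary $\partial\Delta(\mathcal A)$. Then for all $k\ge 0$ we have $\pi_s^{(k+1)}\in\mathrm{ri}(\Delta(\mathcal A))$ for all $s \in \mathcal S$, and for all $s\notin\mathcal S_d$, $a\notin\mathcal A_s^*$, $b\in\mathcal A_s^*$, $$\nabla_a h(\pi_s^{(k+1)})-\nabla_b h(\pi_s^{(k+1)})\ \le\ \nabla_a h(\pi_s^{(0)})-\nabla_b h(\pi_s^{(0)})-\left(\sum_{i=0}^k\eta_i\Delta-\sum_{i=0}^k\eta_iA_i\right).$$
   Context: MDP. $\mathcal S,\mathcal A$ are finite state and action spaces; $P(s'|s,a)$ is the probability of moving to $s'$ after taking action $a$ in state $s$; $R_{s,a}\in[0,1]$; $\gamma\in[0,1)$. $\Delta(\mathcal A)=\{p\in\mathbb R^{|\mathcal A|}:\sum_a p_a=1,\ p_a\ge 0\}$ is the probability simplex, and the policy set is $\Pi=\Delta(\mathcal A)^{|\mathcal S|}$, $\pi=\{\pi_s\}_{s\in\mathcal S}$ with $\pi_{s,a}$ the probability of action $a$ in state $s$. Let $P_{s,s'}(\pi)=\sum_a\pi_{s,a}P(s'|s,a)$, $r_s(\pi)=\sum_a R_{s,a}\pi_{s,a}$, $V(\pi)=(I-\gamma P(\pi))^{-1}r(\pi)\in\mathbb R^{|\mathcal S|}$, $Q_{s,a}(\pi)=R_{s,a}+\gamma\sum_{s'}P(s'|s,a)V_{s'}(\pi)$, and $Q_s(\pi)=(Q_{s,a}(\pi))_{a\in\mathcal A}$. Optimality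 is in the sense of minimization: $V^*$ is the optimal value function, $V^*_s=\min_{\pi\in\Pi}V_s(\pi)$ for all $s$ (attained simultaneously in all states by some policy), and $Q^*_{s,a}=R_{s,a}+\gamma\sum_{s'}P(s'|s,a)V^*_{s'}$ (also written $Q^*(s,a)$; likewise $V^*(s)=V^*_s$). $\Pi^*=\{\pi\in\Pi:V(\pi)=V^*\}$ and $\Pi_s^*=\{\pi_s:\ \pi\in\Pi^*\}$. $\mathcal A_s^*=\{a\in\mathcal A:\ Q^*(s,a)=\min_{a'\in\mathcal A}Q^*(s,a')\}$. The set of dummy states is $\mathcal S_d=\{s\in\mathcal S:\ Q^*(s,a)=V^*(s)\ \forall a\in\mathcal A\}$. The optimal advantage gap (a number, not to be confused with the simplex $\Delta(\mathcal A)$) is $$\Delta=\min_{s\notin\mathcal S_d}\min_{a\notin\mathcal A_s^*}\left(Q^*(s,a)-V^*(s)\right)=\min_{s\notin\mathcal S_d}\min_{a\notin\mathcal A_s^*}\left(Q^*(s,a)-\min_{a'\in\mathcal A}Q^*(s,a')\right)>0.$$ Mirror map. $h$ is a proper convex function on $\mathbb R^{|\mathcal A|}$ with effective domain $\mathrm{dom}(h)\supseteq\Delta(\mathcal A)$, continuously differentiable on $\mathrm{ri}(\Delta(\mathcal A))$. $\nabla_a h$ is the $a$-th component of the gradient $\nabla h$ and $\partial h$ is the convex subdifferential. The Bregman divergence is $D(p,p')=h(p)-h(p')-\langle\nabla h(p'),p-p'\rangle$ for $p,p'\in\Delta(\mathcal A)$ (where $\nabla h(p')$ exists). $\mathrm{ri}$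 denotes relative interior, $\mathrm{cl}$ closure, and $\partial\Delta(\mathcal A)=\mathrm{cl}(\Delta(\mathcal A))\setminus\mathrm{ri}(\Delta(\mathcal A))$. *)

(* Defs.v *)
From HB Require Import structures.
From mathcomp Require Import all_boot all_order all_algebra.
From mathcomp Require Import all_classical all_reals all_analysis.

Set Implicit Arguments.
Unset Strict Implicit.
Unset Printing Implicit Defensive.

Import Order.TTheory GRing.Theory Num.Theory.
Import numFieldNormedType.Exports.

Local Open Scope classical_set_scope.
Local Open Scope ring_scope.

Definition argmin (T : Type) (R : realType) (D : set T) (f : T -> R) : set T :=
  [set x | D x /\ forall y, D y -> f x <= f y].

Definition affine_hull (R : realType) (V : lmodType R) (C : set V) : set V :=
  [set x | exists (n : nat) (c : 'I_n -> R) (y : 'I_n -> V),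
     [/\ forall i, C (y i), \sum_i c i = 1 & x = \sum_i c i *: y i]].

Definition relint (R : realType) (V : normedModType R) (C : set V) : set V :=
  [set x | affine_hull C x /\ \forall y \near x, affine_hull C y -> C y].

Definition dotp (R : realType) (n : nat) (u v : 'rV[R]_n) : R :=
  \sum_i u 0 i * v 0 i.

Definition simplex (R : realType) (n : nat) : set 'rV[R]_n :=
  [set p | \sum_i p 0 i = 1 /\ forall i, 0 <= p 0 i].

Section ConvexAnalysis.
Context (R : realType) (n : nat).
Implicit Types (h : 'rV[R]_n -> \bar R) (p q : 'rV[R]_n).

Definition proper_fun h : Prop :=
  (forall p, h p != -oo%E) /\ (exists p, (h p < +oo)%E).

Definition effective_domain h : set 'rV[R]_n := [set p | (h p < +oo)%E].

(* Only used for proper h, so the right-hand side never meets -oo; at the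
   endpoints t = 0 and t = 1 the convention 0 * +oo = 0 makes it trivial. *)
Definition econvex h : Prop :=
  forall p q (t : R), 0 <= t <= 1 ->
    (h (t *: p + (1 - t) *: q)%R <= t%:E * h p + (1 - t)%:E * h q)%E.

(* Differentiability in the ambient space R^n (not relative to an affine
   subspace).  Finiteness near p is required explicitly because fine +oo = 0. *)
Definition has_gradient h p : Prop :=
  (\forall q \near p, h q \is a fin_num) /\ differentiable (fine \o h) p.

(* Meaningful where has_gradient h p holds. *)
Definition gradient h p : 'rV[R]_n :=
  \row_i 'D_(delta_mx 0 i) (fine \o h) p.

Definition subdifferential h p : set 'rV[R]_n :=
  [set g | forall q, (h p + (dotp g (q - p)%R)%:E <= h q)%E].

Record mirror_map h : Prop := MirrorMap {
  mirror_proper : proper_fun h;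
  mirror_convex : econvex h;
  mirror_dom : @simplex R n `<=` effective_domain h;
  mirror_diff : forall p, relint (@simplex R n) p -> has_gradient h p;
  mirror_C1 : {within relint (@simplex R n), continuous (gradient h)}
}.

(* D(p, q), for p and q in the simplex, where h is finite. *)
Definition bregman h p q : R :=
  fine (h p) - fine (h q) - dotp (gradient h q) (p - q).

(* Extended real: +oo is not excluded a priori. *)
Definition gradient_sup h : \bar R :=
  ereal_sup [set `|gradient h x.2 0 x.1|%:E | x in [set x : 'I_n * 'rV[R]_n |
                                                     simplex x.2]].

End ConvexAnalysis.

Record mdp (R : realType) (S A : finType) := Mdp {
  trans : S -> A -> S -> R;  (* trans s a s' is P(s' | s, a) *)
  cost : S -> A -> R;
  discount : R;
  trans_ge0 : forall s a s', 0 <= trans s a s';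
  trans_sum1 : forall s a, \sum_s' trans s a s' = 1;
  cost_itv : forall s a, 0 <= cost s a <= 1;
  discount_itv : 0 <= discount < 1
}.

Section MDP.
Context (R : realType) (S A : finType) (m : mdp R S A).

(* R^S, R^A and R^(S x A) are matrix spaces, indexed through enum_rank. *)
Implicit Types (pi : 'M[R]_(#|S|, #|A|)).

Definition acoord (v : 'rV[R]_#|A|) (a : A) : R := v 0 (enum_rank a).

Definition policy_at pi (s : S) : 'rV[R]_#|A| := row (enum_rank s) pi.

Definition policies : set 'M[R]_(#|S|, #|A|) :=
  [set pi | forall s, simplex (policy_at pi s)].

Definition trans_mx pi : 'M[R]_#|S| :=
  \matrix_(i, j) \sum_a acoord (policy_at pi (enum_val i)) a
                        * trans m (enum_val i) a (enum_val j).

Definition cost_vec pi : 'cV[R]_#|S| :=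
  \col_i \sum_a cost m (enum_val i) a * acoord (policy_at pi (enum_val i)) a.

Definition value pi (s : S) : R :=
  (invmx (1%:M - discount m *: trans_mx pi) *m cost_vec pi) (enum_rank s) 0.

Definition qvalue_of (V : S -> R) (s : S) (a : A) : R :=
  cost m s a + discount m * \sum_s' trans m s a s' * V s'.

Definition qvalue pi : S -> A -> R := qvalue_of (value pi).

Definition qvec pi (s : S) : 'rV[R]_#|A| := \row_i qvalue pi s (enum_val i).

(* The infima below are minima: V^*_s is attained by an optimal policy, and
   the gap is taken over a finite set, nonempty as soon as some state is not
   dummy. *)
Definition opt_value (s : S) : R := inf [set value pi s | pi in policies].

Definition opt_qvalue : S -> A -> R := qvalue_of opt_value.

Definition opt_policies : set 'M[R]_(#|S|, #|A|) :=
  [set pi | policies pi /\ value pi = opt_value].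

Definition opt_policies_at (s : S) : set 'rV[R]_#|A| :=
  [set policy_at pi s | pi in opt_policies].

Definition opt_actions (s : S) : set A := argmin setT (opt_qvalue s).

Definition dummy_states : set S :=
  [set s | forall a, opt_qvalue s a = opt_value s].

Definition advantage_gap : R :=
  inf [set inf [set opt_qvalue s a - opt_value s | a in ~` opt_actions s]
      | s in ~` dummy_states].

(* Well-posedness of the Bregman divergence (existence of the gradient at the
   current iterate) is not assumed. *)
Definition pmd_sequence (h : 'rV[R]_#|A| -> \bar R) (eta : nat -> R)
    (pi : nat -> 'M[R]_(#|S|, #|A|)) : Prop :=
  forall k s,
    argmin (@simplex R #|A|)
      (fun p => eta k * dotp (qvec (pi k) s) p + bregman h p (policy_at (pi k) s))
      (policy_at (pi k.+1) s).

(* inf {k | eta_k (gap - err_k) > 4 M}, which is +oo when there is no such k. *)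
Definition stopping_index (h : 'rV[R]_#|A| -> \bar R) (eta err : nat -> R) : \bar R :=
  ereal_inf [set k%:R%:E | k in [set k : nat |
    (4%:E * gradient_sup h < (eta k * (advantage_gap - err k))%:E)%E]].

End MDP.

Arguments policies {R S A}.

(* Main.v *)
Require Import Defs.
From HB Require Import structures.
From mathcomp Require Import all_boot all_order all_algebra.
From mathcomp Require Import all_classical all_reals all_analysis.
From mathcomp Require Import ring lra.

(** Policy mirror descent replaces [Q^*] by the action values of the current
policy.  These overestimate [Q^*] by at most [err k], so in a state which is not
dummy every non-optimal action [a] still looks worse than every optimal action
[b] by at least the advantage gap minus [err k] ([qvalue_separation]).

As long as [a] has positive probability in the new policy, a little mass can be
moved from [a] to [b], and the first-order condition at the minimizer
([argmin_simplex_gradient]) says that the difference between the components [a]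
and [b] of the gradient has dropped by at least [eta k] times that amount during
the step ([pmd_step_gap]).  Both conclusions follow from this inequality.

If the gradient is bounded by [M], the difference cannot drop by more than [4 M]
in one step.  Once the step size condition holds, all non-optimal actions have
therefore probability zero, and a policy that only plays optimal actions solves
the evaluation equation of the optimal value ([opt_actions_opt_policy]).  The
Bellman optimality equation behind this argument comes from a deterministic
policy that cannot be improved greedily ([exists_greedy_policy]), and all
comparisons between value functions come from a maximum principle
([discounted_subharmonic_le0]).

If [h] has no subgradient on the relative boundary, the iterates stay in the
relative interior, where all actions have positive probability and the
inequalities of the successive steps telescope.  Staying in the interior is the
delicate point: it requires a subgradient of [h] at every minimizer of [h] plus
a linear form over the simplex ([argmin_simplex_subdifferential]).  It is found
as a cluster point of the gradients along the segment that joins the minimizer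
to the barycenter of the simplex, once these gradients are shown to be bounded
([subdifferential_segment]). *)

Set Implicit Arguments.
Unset Strict Implicit.
Unset Printing Implicit Defensive.

Import Order.TTheory GRing.Theory Num.Theory.
Import numFieldNormedType.Exports.

Local Open Scope classical_set_scope.
Local Open Scope ring_scope.

(** * Discounted Markov decision processes *)

Section MaximumPrinciple.
Context (R : realType) (S : finType).

Lemma exists_max (f : S -> R) (s0 : S) : exists s, forall s', f s' <= f s.
Proof.
by case: (@arg_maxP _ _ S s0 xpredT f isT) => s _ fs; exists s => s'; exact: fs.
Qed.

(** Averaging cannot exceed the maximum, and the discount shrinks a positive
maximum strictly; so a function below its discounted average has no positive
maximum. *)
Lemma discounted_subharmonic_le0 (K : S -> S -> R) (g : R) (u : S -> R) :
  (forall s s', 0 <= K s s') -> (forall s, \sum_s' K s s' = 1) ->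
  0 <= g < 1 -> (forall s, u s <= g * \sum_s' K s s' * u s') ->
  forall s, u s <= 0.
Proof.
move=> K0 K1 /andP[g0 g1] uK s; have [t ut] := exists_max u s.
apply: le_trans (ut s) _.
have avg : \sum_s' K t s' * u s' <= u t.
  rewrite -[leRHS]mul1r -(K1 t) mulr_suml; apply: ler_sum => s' _.
  exact: ler_wpM2l.
have : u t <= g * u t by apply: le_trans (uK t) _; exact: ler_wpM2l.
by nra.
Qed.

End MaximumPrinciple.

Section PolicyEvaluation.
Context (R : realType) (S A : finType) (m : mdp R S A).
Implicit Types (p : 'M[R]_(#|S|, #|A|)) (W : S -> R) (s : S) (a : A).

Definition prob p s a : R := acoord (policy_at p s) a.

Lemma probE p s a : prob p s a = p (enum_rank s) (enum_rank a).
Proof. by rewrite /prob /acoord mxE. Qed.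

Lemma prob_ge0 p s a : policies p -> 0 <= prob p s a.
Proof. by move=> /(_ s)[_]; exact. Qed.

Lemma sum_enum_rank (T : finType) (F : 'I_#|T| -> R) :
  \sum_i F i = \sum_x F (enum_rank x).
Proof. by rewrite (reindex (@enum_rank T)) //; exact/onW_bij/enum_rank_bij. Qed.

Lemma prob_sum1 p s : policies p -> \sum_a prob p s a = 1.
Proof. by move=> /(_ s)[<- _]; rewrite [RHS]sum_enum_rank. Qed.

Definition kernel p s s' : R := \sum_a prob p s a * trans m s a s'.

Lemma kernel_ge0 p s s' : policies p -> 0 <= kernel p s s'.
Proof.
by move=> pp; apply: sumr_ge0 => a _; rewrite mulr_ge0 ?prob_ge0 ?trans_ge0.
Qed.

Lemma kernel_sum1 p s : policies p -> \sum_s' kernel p s s' = 1.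
Proof.
move=> pp; rewrite exchange_big /= -(prob_sum1 s pp).
by apply: eq_bigr => a _; rewrite -mulr_sumr trans_sum1 mulr1.
Qed.

Definition backup p W s : R := \sum_a prob p s a * qvalue_of m W s a.

Lemma backupE p W s : backup p W s =
  \sum_a cost m s a * prob p s a + discount m * \sum_s' kernel p s s' * W s'.
Proof.
under [X in _ + _ * X]eq_bigr do rewrite mulr_suml.
rewrite exchange_big mulr_sumr -big_split /=; apply: eq_bigr => a _.
rewrite /qvalue_of mulrDr [cost _ _ _ * _]mulrC; congr (_ + _).
rewrite mulrCA; congr (_ * _); rewrite mulr_sumr.
by apply: eq_bigr => s' _; rewrite mulrA.
Qed.

(** The maximum principle applied to [W - W'], since the backup operator is
affine with linear part the discounted kernel. *)
Lemma backup_comparison p W W' : policies p ->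
  (forall s, W s <= backup p W s) -> (forall s, backup p W' s <= W' s) ->
  forall s, W s <= W' s.
Proof.
move=> pp WT TW s; rewrite -subr_le0.
apply: (discounted_subharmonic_le0 (K := kernel p) (g := discount m)
  (u := fun s => W s - W' s)).
- by move=> *; exact: kernel_ge0.
- by move=> *; exact: kernel_sum1.
- exact: discount_itv.
move=> t; apply: le_trans (lerB (WT t) (TW t)) _.
rewrite !backupE opprD addrACA subrr add0r -mulrBr -sumrB.
by under eq_bigr do rewrite -mulrBr.
Qed.

(** A kernel vector is a discounted harmonic function, hence zero by the maximum
principle applied to it and to its opposite. *)
Lemma bellman_mx_unit p : policies p ->
  1%:M - discount m *: trans_mx m p \in unitmx.
Proof.
move=> pp; rewrite unitmxE unitfE -det_tr; apply/negP => /det0P[v v0 vM].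
have vE i : v 0 i = discount m * \sum_j trans_mx m p i j * v 0 j.
  have /rowP/(_ i) : (v *m (1%:M - discount m *: trans_mx m p)^T) = 0 by [].
  rewrite linearB /= trmx1 mulmxBr mulmx1 linearZ /= -scalemxAr !mxE.
  move/eqP; rewrite subr_eq0 => /eqP ->; congr (_ * _).
  by apply: eq_bigr => j _; rewrite mxE mulrC.
have uE s : v 0 (enum_rank s) =
    discount m * \sum_s' kernel p s s' * v 0 (enum_rank s').
  rewrite vE sum_enum_rank; congr (_ * _); apply: eq_bigr => s' _.
  by rewrite mxE !enum_rankK.
have v_le0 (e : R) s : e * v 0 (enum_rank s) <= 0.
  apply: (discounted_subharmonic_le0 (K := kernel p) (g := discount m)
    (u := fun s => e * v 0 (enum_rank s))).
  - by move=> *; exact: kernel_ge0.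
  - by move=> *; exact: kernel_sum1.
  - exact: discount_itv.
  move=> t /=; rewrite uE mulrCA le_eqVlt; apply/orP; left; apply/eqP.
  by congr (_ * _); rewrite mulr_sumr; apply: eq_bigr => s' _; rewrite mulrCA.
case/negP: v0; apply/eqP/rowP => i; rewrite mxE -(enum_valK i).
by apply/eqP; rewrite eq_le -[leLHS]mul1r v_le0 -oppr_le0 -mulN1r v_le0.
Qed.

Lemma value_backup p s : policies p -> value m p s = backup p (value m p) s.
Proof.
move=> pp; rewrite backupE.
set M := 1%:M - discount m *: trans_mx m p.
set x := invmx M *m cost_vec m p.
have : (M *m x) (enum_rank s) 0 = cost_vec m p (enum_rank s) 0.
  by rewrite mulKVmx //; exact: bellman_mx_unit.
rewrite /M mulmxBl mul1mx -scalemxAl !mxE enum_rankK => /eqP.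
rewrite subr_eq => /eqP xE; rewrite /value -/M -/x {1}/x mxE xE.
congr (_ + _ * _).
rewrite sum_enum_rank; apply: eq_bigr => s' _.
by rewrite mxE !enum_rankK.
Qed.

Lemma le_value p W : policies p ->
  (forall s, W s <= backup p W s) -> forall s, W s <= value m p s.
Proof.
by move=> pp WT; apply: (backup_comparison pp) => // s; rewrite -value_backup.
Qed.

Lemma value_le p W : policies p ->
  (forall s, backup p W s <= W s) -> forall s, value m p s <= W s.
Proof.
by move=> pp TW; apply: (backup_comparison pp) => // s; rewrite -value_backup.
Qed.

Lemma le_backup p W W' s : policies p ->
  (forall a, W' s <= qvalue_of m W s a) -> W' s <= backup p W s.
Proof.
move=> pp le_q; rewrite -[leLHS]mul1r -(prob_sum1 s pp) mulr_suml.
by apply: ler_sum => a _; rewrite ler_wpM2l ?prob_ge0.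
Qed.

Lemma le_qvalue W W' s a :
  (forall s, W s <= W' s) -> qvalue_of m W s a <= qvalue_of m W' s a.
Proof.
move=> WW'; rewrite lerD2l ler_wpM2l //.
  by have /andP[] := discount_itv m.
by apply: ler_sum => s' _; rewrite ler_wpM2l ?trans_ge0.
Qed.

End PolicyEvaluation.

Section Optimality.
Context (R : realType) (S A : finType) (m : mdp R S A).
Implicit Types (p : 'M[R]_(#|S|, #|A|)) (W : S -> R) (s : S) (a : A).

Definition det_policy (f : {ffun S -> A}) : 'M[R]_(#|S|, #|A|) :=
  \matrix_(i, j) (enum_val j == f (enum_val i))%:R.

Lemma prob_det f s a : prob (det_policy f) s a = (a == f s)%:R.
Proof. by rewrite probE mxE !enum_rankK. Qed.

Lemma det_policy_policies f : policies (det_policy f).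
Proof.
move=> s; split; last by move=> i; rewrite !mxE ler0n.
rewrite sum_enum_rank (bigD1 (f s)) //= big1 => [|a /negPf afs].
  by rewrite -[X in X + _]/(prob _ _ _) prob_det eqxx addr0.
by rewrite -[LHS]/(prob _ _ _) prob_det afs.
Qed.

Lemma backup_det f W s : backup m (det_policy f) W s = qvalue_of m W s (f s).
Proof.
rewrite /backup (bigD1 (f s)) //= prob_det eqxx mul1r big1 ?addr0 //.
by move=> a /negPf afs; rewrite prob_det afs mul0r.
Qed.

(** Howard's policy improvement: acting greedily for the value of [f] can only
lower the value, in every state.  Hence a deterministic policy with the least
total value is unchanged, in value, by its own greedy improvement, which says
that it satisfies the Bellman optimality inequality. *)
Lemma exists_greedy_policy (a0 : A) : exists f : {ffun S -> A},
  forall s a, value m (det_policy f) s <= qvalue m (det_policy f) s a.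
Proof.
pose total (f : {ffun S -> A}) := \sum_s value m (det_policy f) s.
have [f fmin] : exists f, forall g, total f <= total g.
  have [f fmax] := exists_max (fun f => - total f) [ffun=> a0].
  by exists f => g; rewrite -lerN2.
exists f; pose V := value m (det_policy f).
have gP s : exists a, forall a', qvalue_of m V s a <= qvalue_of m V s a'.
  have [a amax] := exists_max (fun a => - qvalue_of m V s a) a0.
  by exists a => a'; rewrite -lerN2.
have [g gmin] := choice gP; pose g' := [ffun s => g s].
have Vg s : value m (det_policy g') s <= V s.
  apply: value_le => [|t]; first exact: det_policy_policies.
  rewrite backup_det ffunE {2}/V value_backup; last exact: det_policy_policies.
  by rewrite backup_det; exact: gmin.
have VgE s : value m (det_policy g') s = V s.
  apply/eqP; rewrite eq_le Vg /= -subr_le0.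
  have d_ge0 t : 0 <= V t - value m (det_policy g') t by rewrite subr_ge0.
  apply: le_trans (_ : \sum_t (V t - value m (det_policy g') t) <= 0).
    by rewrite (bigD1 s) //= lerDl sumr_ge0.
  by rewrite sumrB subr_le0; exact: fmin.
move=> s a; rewrite -/(V s) -VgE value_backup; last exact: det_policy_policies.
rewrite backup_det ffunE; apply: le_trans (gmin s a).
by apply: le_qvalue => t; rewrite VgE.
Qed.

Lemma greedy_value_le p p' : policies p -> policies p' ->
  (forall s a, value m p s <= qvalue m p s a) ->
  forall s, value m p s <= value m p' s.
Proof.
move=> pp pp' le_q; apply: le_value => // s.
by apply: le_backup => // a; exact: le_q.
Qed.

Lemma exists_opt_policy (a0 : A) : exists2 p, opt_policies m p &
  forall p' s, policies p' -> value m p s <= value m p' s.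
Proof.
have [f fopt] := exists_greedy_policy a0; have pf := det_policy_policies f.
have f_le p' s : policies p' -> value m (det_policy f) s <= value m p' s.
  by move=> pp'; exact: greedy_value_le.
exists (det_policy f) => //; split=> //; apply/funext => s.
apply/eqP; rewrite eq_le; apply/andP; split.
  apply: lb_le_inf; first by exists (value m (det_policy f) s), (det_policy f).
  by move=> _ [p' pp' <-]; exact: f_le.
apply: ge_inf; last by exists (det_policy f).
by exists (value m (det_policy f) s) => _ [p' pp' <-]; exact: f_le.
Qed.

Lemma opt_value_le (a0 : A) p s : policies p -> opt_value m s <= value m p s.
Proof.
by move=> pp; have [q [pq <-]] := exists_opt_policy a0; exact.
Qed.

Lemma opt_qvalue_le (a0 : A) p s a :
  policies p -> opt_qvalue m s a <= qvalue m p s a.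
Proof. by move=> pp; apply: le_qvalue => t; exact: opt_value_le. Qed.

(** The greedy policy of [exists_greedy_policy] is optimal, hence its Bellman
optimality inequality is one for the optimal value. *)
Lemma opt_value_le_qvalue s a : opt_value m s <= opt_qvalue m s a.
Proof.
have [f fopt] := exists_greedy_policy a; have pf := det_policy_policies f.
have Vf : value m (det_policy f) = opt_value m.
  apply/funext => t; apply/eqP; rewrite eq_le opt_value_le // andbT.
  have [q [pq <-] _] := exists_opt_policy a; exact: greedy_value_le.
by have := fopt s a; rewrite /qvalue Vf.
Qed.

(** The Bellman optimality equation: the value of an optimal policy averages
[Q^*], so it is at least the minimum of [Q^*]. *)
Lemma opt_action_qvalue s b :
  opt_actions m s b -> opt_qvalue m s b = opt_value m s.
Proof.
move=> [_ bmin]; apply/eqP; rewrite eq_le opt_value_le_qvalue andbT.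
have [q [pq Vq] _] := exists_opt_policy b.
rewrite -Vq value_backup // Vq.
by apply: (le_backup (W' := fun=> opt_qvalue m s b)) => // a; exact: bmin.
Qed.

Lemma dummy_opt_actions s a : dummy_states m s -> opt_actions m s a.
Proof. by move=> sd; split=> // a' _; rewrite !sd. Qed.

(** Such a policy turns the Bellman optimality equation into its own evaluation
equation, whose only solution is its value. *)
Lemma opt_actions_opt_policy p : policies p ->
  (forall s a, 0 < prob p s a -> opt_actions m s a) -> opt_policies m p.
Proof.
move=> pp p_opt.
have backup_opt s : backup m p (opt_value m) s = opt_value m s.
  rewrite -[RHS]mul1r -(prob_sum1 s pp) mulr_suml; apply: eq_bigr => a _.
  have := prob_ge0 s a pp; rewrite le_eqVlt => /predU1P[<-|/p_opt aopt].
    by rewrite !mul0r.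
  by congr (_ * _); exact: opt_action_qvalue.
split=> //; apply/funext => s; apply/eqP; rewrite eq_le.
by rewrite value_le ?le_value // => t; rewrite backup_opt.
Qed.

Lemma advantage_gap_le s a : ~ dummy_states m s -> ~ opt_actions m s a ->
  advantage_gap m <= opt_qvalue m s a - opt_value m s.
Proof.
move=> sd aopt.
have adv_lb t : lbound
    [set opt_qvalue m t b - opt_value m t | b in ~` opt_actions m t] 0.
  by move=> _ [b _ <-]; rewrite subr_ge0 opt_value_le_qvalue.
have adv_inf t : 0 <=
    inf [set opt_qvalue m t b - opt_value m t | b in ~` opt_actions m t].
  set E := [set _ | _ in _]; have [->|/set0P E0] := eqVneq E set0.
    by rewrite inf0.
  exact: lb_le_inf E0 (adv_lb t).
apply: (@le_trans _ _
    (inf [set opt_qvalue m s b - opt_value m s | b in ~` opt_actions m s])).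
  apply: ge_inf; last by exists s.
  by exists 0 => _ [t _ <-]; exact: adv_inf.
by apply: ge_inf; [exists 0; exact: adv_lb | exists a].
Qed.

(** A uniformly good estimate of [Q^*] from above still separates the optimal
actions from the others by the gap up to the error. *)
Lemma qvalue_separation p e s a b : policies p ->
  (forall t c, qvalue m p t c - opt_qvalue m t c <= e) ->
  ~ dummy_states m s -> ~ opt_actions m s a -> opt_actions m s b ->
  advantage_gap m - e <= qvalue m p s a - qvalue m p s b.
Proof.
move=> pp err_e sd aopt bopt; have := advantage_gap_le sd aopt.
have := opt_qvalue_le a s a pp; have := err_e s b.
rewrite (opt_action_qvalue bopt).
lra.
Qed.

End Optimality.

(** * Relative interiors *)

Lemma near_segment (R : realType) (V : normedModType R) (x v : V) (P : set V) :
  (\forall y \near x, P y) -> \forall t \near (0 : R)^'+, P (x + t *: v).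
Proof.
have cont : x + t *: v @[t --> (0 : R)] --> x.
  have -> : nbhs x = nbhs (x + (0 : R) *: v) by rewrite scale0r addr0.
  by apply: cvgD; [exact: cvg_cst | exact: scalel_continuous].
move=> Px; exact: (cvg_at_right_filter cont Px).
Qed.

(** The line through [x] and [y] lies in the affine hull of [C], and the part of
the affine hull that is close to [x] lies in [C]. *)
Lemma relint_extend (R : realType) (V : normedModType R) (C : set V) (x y : V) :
  relint C x -> C y -> exists2 t : R, 0 < t & C (x + t *: (x - y)).
Proof.
move=> [Hx Cx] Cy; have xC : C x := nbhs_singleton Cx Hx.
have : \forall t \near (0 : R)^'+,
    affine_hull C (x + t *: (x - y)) -> C (x + t *: (x - y)).
  exact: (near_segment _ Cx).
move=> near_C; near (0 : R)^'+ => t.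
exists t; first by near: t; exact: nbhs_right_gt.
have : affine_hull C (x + t *: (x - y)) -> C (x + t *: (x - y)) by near: t.
apply.
(* The point is the affine combination (1 + t) x - t y. *)
exists 2%N, (fun i : 'I_2 => if i == ord0 then 1 + t else - t),
  (fun i : 'I_2 => if i == ord0 then x else y).
split=> [i||]; rewrite ?big_ord_recl ?big_ord0 /=; first by case: ifP.
  by rewrite addr0 addrK.
by rewrite addr0 scalerDl scale1r scalerBr scaleNr addrA.
Unshelve. all: by end_near. Qed.

Section Simplex.
Context (R : realType) (n : nat).
Implicit Types (p q : 'rV[R]_n) (i j : 'I_n).

Lemma simplex_delta i : simplex (delta_mx 0 i : 'rV[R]_n).
Proof.
split=> [|j]; last by rewrite !mxE ler0n.
rewrite (bigD1 i) //= big1 => [|j /negPf ji]; rewrite mxE ?eqxx ?addr0 //.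
by rewrite ji.
Qed.

Lemma simplex_affine_hull p :
  affine_hull (@simplex R n) p -> \sum_i p 0 i = 1.
Proof.
move=> [k [c [y [Cy c1 ->]]]]; under eq_bigr do rewrite summxE.
rewrite exchange_big -c1 /=; apply: eq_bigr => j _.
have [yj1 _] := Cy j; under eq_bigr do rewrite mxE.
by rewrite -mulr_sumr yj1 mulr1.
Qed.

Lemma relint_simplexP p :
  relint (@simplex R n) p <-> simplex p /\ forall i, 0 < p 0 i.
Proof.
split=> [pri|[[p1 _] p_gt0]].
  have [p1 p_ge0] : simplex p by case: pri => Hp /nbhs_singleton; exact.
  split=> // i; rewrite lt_neqAle p_ge0 andbT eq_sym; apply/eqP => pi0.
  have [t t0 [_ /(_ i)]] := relint_extend pri (simplex_delta i).
  by rewrite !mxE pi0 !eqxx !add0r mulrN mulr1 oppr_ge0 leNgt t0.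
split.
  exists 1%N, (fun=> 1), (fun=> p); split=> [_||].
  - by split=> // i; exact: ltW.
  - by rewrite big_ord_recl big_ord0 addr0.
  - by rewrite big_ord_recl big_ord0 addr0 scale1r.
have near_ge0 : \forall q \near p, forall i, 0 <= (q : 'rV[R]_n) 0 i.
  apply: (@filter_forall _ _ (fun i (q : 'rV[R]_n) => 0 <= q 0 i)
    (nbhs p) (nbhs_filter p)).
  move=> i.
  have := @cvgr_gt _ _ _ (nbhs_filter p) _ (p 0 i)
    (@coord_continuous R 1 n 0 i p) 0 (p_gt0 i).
  by apply: filterS => q /ltW.
apply: filterS near_ge0 => q q_ge0 /simplex_affine_hull q1.
by split.
Qed.

End Simplex.

(** * Differentiable convex functions *)

Section Gradient.
Context (R : realType) (n : nat).
Implicit Types (h : 'rV[R]_n -> \bar R) (c p q v : 'rV[R]_n).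

Lemma dotpDr c p q : dotp c (p + q) = dotp c p + dotp c q.
Proof. by rewrite -big_split; apply: eq_bigr => i _; rewrite mxE mulrDr. Qed.

Lemma dotpZr c (t : R) p : dotp c (t *: p) = t * dotp c p.
Proof. by rewrite mulr_sumr; apply: eq_bigr => i _; rewrite mxE mulrCA. Qed.

Lemma dotpNr c p : dotp c (- p) = - dotp c p.
Proof. by rewrite -scaleN1r dotpZr mulN1r. Qed.

Lemma dotp0r c : dotp c 0 = 0.
Proof. by rewrite -(subrr 0) dotpDr dotpNr subrr. Qed.

Lemma dotp_delta c i : dotp c (delta_mx 0 i) = c 0 i.
Proof.
rewrite /dotp (bigD1 i) //= big1 => [|j /negPf ji]; rewrite mxE ?eqxx.
  by rewrite mulr1 addr0.
by rewrite ji mulr0.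
Qed.

Lemma dotp_continuous v : continuous (fun c : 'rV[R]_n => dotp c v).
Proof.
apply: continuous_big => [|i _ c]; first exact: add_continuous.
by apply: continuousM; [exact: coord_continuous | exact: cst_continuous].
Qed.

Lemma derive_gradient h p v :
  has_gradient h p -> 'D_v (fine \o h) p = dotp (gradient h p) v.
Proof.
move=> [_ dh]; rewrite deriveE // {1}(row_sum_delta v) linear_sum.
by apply: eq_bigr => i _; rewrite linearZ /= mxE deriveE // mulrC.
Qed.

Lemma ge_derive h p v (d : R) : has_gradient h p ->
  (\forall t \near 0^'+, t * d <= fine (h (p + t *: v)) - fine (h p)) ->
  d <= dotp (gradient h p) v.
Proof.
move=> hp le_quot; rewrite -derive_gradient //.
have der : derivable (fine \o h) p v by apply: diff_derivable; case: hp.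
apply: (cvgr_to_ge (cvg_dnbhs_at_right der)).
near=> t; have t0 : 0 < t by near: t; exact: nbhs_right_gt.
rewrite /= -[leRHS]/(t^-1 * _) -[leLHS](mulKf (lt0r_neq0 t0)).
by rewrite ler_pM2l ?invr_gt0 // [_ + p]addrC; near: t.
Unshelve. all: by end_near. Qed.

Lemma has_gradient_fin h p : has_gradient h p -> h p \is a fin_num.
Proof. by move=> [/nbhs_singleton]. Qed.

Lemma econvex_fine h p q (t : R) : proper_fun h -> econvex h ->
  h p \is a fin_num -> h q \is a fin_num -> 0 <= t <= 1 ->
  fine (h (t *: p + (1 - t) *: q)) <= t * fine (h p) + (1 - t) * fine (h q).
Proof.
move=> [hNy _] hconv /fineK hp /fineK hq t01; have := hconv p q t t01.
rewrite -hp -hq -!EFinM -EFinD; have := hNy (t *: p + (1 - t) *: q).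
by case: (h _).
Qed.

(** Going backwards from [p], away from [q], convexity bounds the increase of
[h] from below by the slope of the chord between [p] and [q]. *)
Lemma gradient_subdifferential h p :
  proper_fun h -> econvex h -> has_gradient h p ->
  subdifferential h p (gradient h p).
Proof.
move=> hprop hconv hp q; have pfin := has_gradient_fin hp.
have [qfin|] := boolP (h q \is a fin_num); last first.
  rewrite fin_numE (proj1 hprop q) /= negbK => /eqP ->; exact: leey.
rewrite -(fineK pfin) -(fineK qfin) -EFinD lee_fin addrC -lerBrDr.
rewrite -lerN2 opprB -dotpNr opprB; apply: ge_derive => //.
have near_fin : \forall t \near (0 : R)^'+, h (p + t *: (p - q)) \is a fin_num.
  by case: hp => hp _; exact: (near_segment _ hp).
near=> t; have t0 : 0 < t by near: t; exact: nbhs_right_gt.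
have xfin : h (p + t *: (p - q)) \is a fin_num by near: t.
have t1 : 1 + t != 0 by lra.
have s01 : 0 <= (1 + t)^-1 <= 1 by rewrite invr_ge0 invf_le1; lra.
have := econvex_fine hprop hconv xfin qfin s01.
(* [p] is a convex combination of the two points. *)
have -> : (1 + t)^-1 *: (p + t *: (p - q)) + (1 - (1 + t)^-1) *: q = p.
  by apply/rowP => i; rewrite !mxE; field.
set fx := fine (h (p + _)); set fp := fine (h p); set fq := fine (h q).
rewrite -(ler_pM2l (_ : 0 < 1 + t)); last by lra.
have -> : (1 + t) * ((1 + t)^-1 * fx + (1 - (1 + t)^-1) * fq) = fx + t * fq.
  by field.
by lra.
Unshelve. all: by end_near. Qed.

(** Moving a little mass from a coordinate [i] in the support to [j] stays in
the simplex, so it cannot decrease the objective to first order. *)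
Lemma argmin_simplex_gradient h c p i j :
  argmin (@simplex R n) (fun q => fine (h q) + dotp c q) p ->
  has_gradient h p -> 0 < p 0 i ->
  gradient h p 0 i + c 0 i <= gradient h p 0 j + c 0 j.
Proof.
move=> [[p1 p_ge0] pmin] hp pi_gt0.
set v : 'rV[R]_n := delta_mx 0 j - delta_mx 0 i.
have dotv d : dotp d v = d 0 j - d 0 i by rewrite dotpDr dotpNr !dotp_delta.
suff : c 0 i - c 0 j <= dotp (gradient h p) v by rewrite dotv; lra.
apply: ge_derive => //; near=> t.
have t0 : 0 < t by near: t; exact: nbhs_right_gt.
have tp : t < p 0 i by near: t; exact: nbhs_right_lt.
have /pmin : simplex (p + t *: v).
  have sumE q : \sum_k q 0 k = dotp (const_mx 1) q.
    by apply: eq_bigr => k _; rewrite mxE mul1r.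
  split=> [|k].
    by rewrite sumE dotpDr dotpZr dotv !mxE subrr mulr0 addr0 -sumE.
  rewrite !mxE eqxx /=; have := p_ge0 k; have [->|] := eqVneq k i.
    by case: (i == j) => /=; lra.
  by case: (k == j) => /=; lra.
rewrite dotpDr dotpZr dotv; lra.
Unshelve. all: by end_near. Qed.

(** The subgradients at the points [x t] of the segment from [p] to [q] stay
bounded as [x t] tends to [p].  On the one hand, minimality of [p] prevents the
slope of [h] along the segment from tending to minus infinity; on the other
hand, [h] is finite around [q], and the subgradient inequality at the points
[q + w] for small [w] then bounds every component.  A cluster point is a
subgradient at [p]: minimality also gives the lower semicontinuity of [h] at [p]
along the segment. *)
Lemma subdifferential_segment h c p q :
  proper_fun h -> econvex h -> h p \is a fin_num ->
  (forall t, 0 < t <= 1 -> has_gradient h (p + t *: (q - p)) /\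
     fine (h p) + dotp c p <=
     fine (h (p + t *: (q - p))) + dotp c (p + t *: (q - p))) ->
  subdifferential h p !=set0.
Proof.
move=> hprop hconv pfin segm; set v := q - p in segm *.
pose x t := p + t *: v; pose g t := gradient h (x t).
have x1 : x 1 = q by rewrite /x scale1r addrC subrK.
have hq : has_gradient h q by rewrite -x1; apply: (proj1 (segm 1 _)); lra.
have subg t y : 0 < t <= 1 -> h y \is a fin_num ->
    fine (h (x t)) + dotp (g t) (y - p) - t * dotp (g t) v <= fine (h y).
  move=> t01 yfin; have [ht _] := segm t t01.
  have := gradient_subdifferential hprop hconv ht y.
  rewrite -{1}(fineK yfin) -{1}(fineK (has_gradient_fin ht)) -EFinD lee_fin.
  by rewrite opprD addrA (dotpDr _ (y - p)) dotpNr dotpZr addrA.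
have lsc t : 0 < t <= 1 -> fine (h p) - t * dotp c v <= fine (h (x t)).
  by move=> /segm[_]; rewrite dotpDr dotpZr -/(x t); lra.
have slope_ge t : 0 < t <= 1 -> - dotp c v <= dotp (g t) v.
  move=> t01; have := subg t p t01 pfin; have := lsc t t01.
  rewrite subrr dotp0r.
  by case/andP: t01 => t0 _; nra.
(* The subgradient inequality at [q + w], with the two bounds above. *)
pose B w := fine (h (q + w)) - fine (h p) + dotp c v.
have le_B t w : 0 < t <= 1 -> h (q + w) \is a fin_num -> dotp (g t) w <= B w.
  move=> t01 wfin; have := subg t _ t01 wfin.
  have := lsc t t01; have := slope_ge t t01.
  have -> : q + w - p = v + w by rewrite addrAC.
  by rewrite dotpDr /B; case/andP: t01 => t0 t1; nra.
(* The steps [w] along the coordinate axes bound every component of [g t]. *)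
have [r [r0 rfin]] : exists r : R, 0 < r /\ forall i : 'I_n,
    h (q + r *: delta_mx 0 i) \is a fin_num /\
    h (q + r *: - delta_mx 0 i) \is a fin_num.
  have near_fin w : \forall r \near (0 : R)^'+, h (q + r *: w) \is a fin_num.
    by case: hq => hq _; exact: (near_segment _ hq).
  apply: (@filter_ex _ (0 : R)^'+); apply: filterI; first exact: nbhs_right_gt.
  apply: (@filter_forall R _ _ (0 : R)^'+ _) => i.
  exact: filterI (near_fin _) (near_fin _).
pose box := [set w : 'rV[R]_n | forall i : 'I_n,
  [set` `[- (B (r *: - delta_mx 0 i) / r), B (r *: delta_mx 0 i) / r]]
    (w ord0 i)].
have box_compact : compact box.
  apply: (rV_compact (A := fun i => [set` _])) => i; exact: segment_compact.
have g_box : \forall t \near (0 : R)^'+, box (g t).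
  near=> t; have t01 : 0 < t <= 1.
    apply/andP; split; near: t; first exact: nbhs_right_gt.
    exact: nbhs_right_le.
  move=> i /=; have [fin_r fin_l] := rfin i.
  have := le_B t _ t01 fin_r; have := le_B t _ t01 fin_l.
  rewrite !dotpZr dotpNr dotp_delta in_itv /= => le_l le_r.
  by rewrite lerNl !ler_pdivlMr // mulrC mulrN [_ * r]mulrC -mulrN le_l le_r.
have [G [_ G_cluster]] := box_compact (g @ (0 : R)^'+) _ g_box.
exists G => y; have [yfin|] := boolP (h y \is a fin_num); last first.
  rewrite fin_numE (proj1 hprop y) /= negbK => /eqP ->; exact: leey.
rewrite -(fineK pfin) -(fineK yfin) -EFinD lee_fin.
apply/ler_addgt0Pr => e e0.
(* A cluster point satisfies every closed condition that holds near [0]. *)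
pose half := [set w : 'rV[R]_n | dotp w (y - p) <= fine (h y) - fine (h p) + e].
have half_closed : closed half.
  exact: (closed_comp (fun w _ => @dotp_continuous (y - p) w) (@closed_le _ _)).
suff near_g : \forall t \near (0 : R)^'+, half (g t).
  move: G_cluster; rewrite clusterE => /(_ half near_g)/half_closed.
  by rewrite /half /=; lra.
pose D := fine (h q) - fine (h p) + dotp c v.
have D0 : 0 <= D.
  have t01 : 0 < (1 : R) <= 1 by lra.
  have := le_B 1 0 t01; rewrite dotp0r /B addr0; apply.
  exact: has_gradient_fin.
near=> t; have t0 : 0 < t by near: t; exact: nbhs_right_gt.
have t2 : t <= 1 / 2 by near: t; apply: nbhs_right_le; lra.
(* The added 1 keeps the quotient meaningful when [D] vanishes. *)
have te : t < e / (2 * D + 1).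
  by near: t; apply: nbhs_right_lt; rewrite divr_gt0 //; lra.
have tD : t * (2 * D) <= e by move: te; rewrite ltr_pdivlMr; [nra | lra].
have t01 : 0 < t <= 1 by lra.
have slope_le : dotp (g t) v <= 2 * D - dotp c v.
  have := subg t _ t01 (has_gradient_fin hq); have := lsc t t01.
  have := slope_ge t t01; rewrite -/v /D; nra.
have := subg t _ t01 yfin; have := lsc t t01; rewrite /half /=; nra.
Unshelve. all: by end_near. Qed.

(** The segment from a minimizer to the barycenter runs, but for its start, in
the relative interior of the simplex, where [h] is differentiable. *)
Lemma argmin_simplex_subdifferential h c p : mirror_map h ->
  argmin (@simplex R n) (fun q => fine (h q) + dotp c q) p ->
  subdifferential h p !=set0.
Proof.
move=> [hprop hconv hdom hdiff _] [[p1 p_ge0] pmin].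
have n0 : (0 < n)%N.
  by rewrite lt0n; apply/eqP => n0; move: p1; subst n; rewrite big_ord0; lra.
have pfin : h p \is a fin_num.
  by rewrite fin_numE (proj1 hprop) lt_eqF //; exact: hdom.
pose q : 'rV[R]_n := const_mx n%:R^-1.
apply: (@subdifferential_segment h c p q) => // t /andP[t0 t1].
have ri_x : relint (@simplex R n) (p + t *: (q - p)).
  apply/relint_simplexP.
  have x_gt0 i : 0 < (p + t *: (q - p)) 0 i.
    rewrite !mxE; have := p_ge0 i; have : 0 < n%:R^-1 :> R.
      by rewrite invr_gt0 ltr0n.
    by nra.
  split=> //; split=> [|i]; last exact: ltW.
  under eq_bigr do rewrite !mxE.
  rewrite big_split -mulr_sumr sumrB /= p1 sumr_const card_ord.
  rewrite -[n%:R^-1 *+ n]mulr_natr mulVf ?pnatr_eq0 -?lt0n //.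
  by rewrite subrr mulr0 addr0.
split; first exact: hdiff.
by apply: pmin; case/relint_simplexP: ri_x.
Qed.

End Gradient.

(** * Policy mirror descent *)

Section MirrorDescent.
Context (R : realType) (S A : finType) (m : mdp R S A).
Context (h : 'rV[R]_#|A| -> \bar R) (eta err : nat -> R).
Context (pi : nat -> 'M[R]_(#|S|, #|A|)).
Context (hmirror : mirror_map h).
Context (policies_pi : forall k, policies (pi k)).
Context (pmd_pi : pmd_sequence m h eta pi).
Implicit Types (k : nat) (s : S) (a b : A).

Let grad k s a := acoord (gradient h (policy_at (pi k) s)) a.

(** Up to terms that do not depend on the new policy, the objective of a step is
[h] tilted by a linear form. *)
Lemma pmd_step_argmin k s :
  argmin (@simplex R #|A|)
    (fun q => fine (h q) + dotp (eta k *: qvec m (pi k) s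
                                 - gradient h (policy_at (pi k) s)) q)
    (policy_at (pi k.+1) s).
Proof.
have [p_simplex pmin] := pmd_pi k s; split=> // q /pmin.
have tiltE z : dotp (eta k *: qvec m (pi k) s
    - gradient h (policy_at (pi k) s)) z = eta k * dotp (qvec m (pi k) s) z
    - dotp (gradient h (policy_at (pi k) s)) z.
  by rewrite mulr_sumr -sumrB; apply: eq_bigr => i _; rewrite !mxE mulrBl mulrA.
by rewrite !tiltE /bregman !dotpDr !dotpNr; lra.
Qed.

Lemma pmd_step_gradient k s a b :
  has_gradient h (policy_at (pi k.+1) s) -> 0 < prob (pi k.+1) s a ->
  grad k.+1 s a - grad k.+1 s b <= grad k s a - grad k s b
    - eta k * (qvalue m (pi k) s a - qvalue m (pi k) s b).
Proof.
move=> hgrad pa; have := argmin_simplex_gradient (enum_rank b)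
  (pmd_step_argmin k s) hgrad pa.
by rewrite /grad /acoord !mxE !enum_rankK; lra.
Qed.

Context (eta_gt0 : forall k, 0 < eta k).
Context (err_bound :
  forall s a k, qvalue m (pi k) s a - opt_qvalue m s a <= err k).

Lemma pmd_step_gap k s a b : ~ dummy_states m s ->
  ~ opt_actions m s a -> opt_actions m s b ->
  has_gradient h (policy_at (pi k.+1) s) -> 0 < prob (pi k.+1) s a ->
  grad k.+1 s a - grad k.+1 s b <=
    grad k s a - grad k s b - eta k * (advantage_gap m - err k).
Proof.
move=> sd aopt bopt hgrad pa; apply: le_trans (pmd_step_gradient b hgrad pa) _.
rewrite lerD2l lerN2 ler_pM2l //.
by apply: qvalue_separation => // t c; exact: err_bound.
Qed.

(** A non-optimal action kept in the support would force the gradient gap, whose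
variation in one step is at most four times the bound on the gradient, to drop
by more than that. *)
Lemma pmd_optimal k : (forall p, simplex p -> has_gradient h p) ->
  (4%:E * gradient_sup h < (eta k * (advantage_gap m - err k))%:E)%E ->
  opt_policies m (pi k.+1).
Proof.
move=> hgrad step_large; apply: opt_actions_opt_policy => // s a pa.
apply: contrapT => aopt.
have sd : ~ dummy_states m s by move=> sd; exact/aopt/dummy_opt_actions.
have [b bopt] : exists b, opt_actions m s b.
  have [b bmax] := exists_max (fun b => - opt_qvalue m s b) a.
  by exists b; split=> // c _; rewrite -lerN2.
have pol i : simplex (policy_at (pi i) s) by exact: policies_pi.
have := pmd_step_gap sd aopt bopt (hgrad _ (pol k.+1)) pa.
have grad_sup i c : (`|grad i s c|%:E <= gradient_sup h)%E.
  apply: ereal_sup_ubound.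
  by exists (enum_rank c, policy_at (pi i) s) => //; exact: pol.
move: step_large (grad_sup k a) (grad_sup k b) (grad_sup k.+1 a)
  (grad_sup k.+1 b).
case: (gradient_sup h) => [M||] //; last by rewrite gt0_muley ?lte_fin.
rewrite -EFinM lte_fin !lee_fin !ler_norml.
lra.
Qed.

(** A minimizer on the boundary would still carry a subgradient. *)
Lemma pmd_relint k s :
  (forall p, (closure (@simplex R #|A|) `\` relint (@simplex R #|A|)) p ->
     subdifferential h p = set0) ->
  relint (@simplex R #|A|) (policy_at (pi k.+1) s).
Proof.
move=> no_subgradient; apply: contrapT => not_ri.
have [g] := argmin_simplex_subdifferential hmirror (pmd_step_argmin k s).
by rewrite no_subgradient //; split=> //; exact/subset_closure/policies_pi.
Qed.

Lemma pmd_gradient_sum k s a b : ~ dummy_states m s ->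
  ~ opt_actions m s a -> opt_actions m s b ->
  (forall i, relint (@simplex R #|A|) (policy_at (pi i.+1) s)) ->
  grad k s a - grad k s b <= grad 0 s a - grad 0 s b -
    (\sum_(0 <= i < k) eta i * advantage_gap m
     - \sum_(0 <= i < k) eta i * err i).
Proof.
move=> sd aopt bopt ri; elim: k => [|k IHk]; first by rewrite !big_nil !subr0.
have hgrad : has_gradient h (policy_at (pi k.+1) s).
  exact: (mirror_diff hmirror).
have [_ /(_ (enum_rank a)) pa] := (relint_simplexP _).1 (ri k).
have := pmd_step_gap sd aopt bopt hgrad pa.
rewrite !big_nat_recr //=; lra.
Qed.

End MirrorDescent.

Lemma gradient_sup_ge0 (R : realType) (n : nat) (h : 'rV[R]_n -> \bar R)
  (i : 'I_n) : (0 <= gradient_sup h)%E.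
Proof.
apply: (@le_trans _ _ `|gradient h (delta_mx 0 i) 0 i|%:E).
  by rewrite lee_fin.
apply: ereal_sup_ubound.
by exists (i, delta_mx 0 i) => //; exact: simplex_delta.
Qed.

(** The step size condition is inherited by the later steps: since the supremum
of the gradient is nonnegative, the condition makes the gap exceed the error,
and from there on the step size and the gap minus the error are both
nonnegative and nondecreasing. *)
Lemma stopping_index_le (R : realType) (S A : finType) (m : mdp R S A)
    (h : 'rV[R]_#|A| -> \bar R) (eta err : nat -> R) (k : nat) (a0 : A) :
  nondecreasing_seq eta -> (forall k, 0 < eta k) -> nonincreasing_seq err ->
  (stopping_index m h eta err <= k%:R%:E)%E ->
  (4%:E * gradient_sup h < (eta k * (advantage_gap m - err k))%:E)%E.
Proof.
move=> eta_nd eta_gt0 err_ni le_k.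
have /ereal_inf_lt[_ [k0 large <-]] :
    (stopping_index m h eta err < k.+1%:R%:E)%E.
  by apply: le_lt_trans le_k _; rewrite lte_fin ltr_nat.
rewrite lte_fin ltr_nat ltnS => k0k; apply: lt_le_trans (large) _.
have gap0 : 0 < advantage_gap m - err k0.
  rewrite -(pmulr_rgt0 _ (eta_gt0 k0)) -lte_fin; apply: le_lt_trans large.
  by rewrite mule_ge0 ?lee_fin // gradient_sup_ge0 //; exact: enum_rank a0.
rewrite lee_fin; apply: ler_pM; [exact: ltW | exact: ltW | exact: eta_nd |].
by rewrite lerB // err_ni.
Qed.

Theorem theorem4p3 (R : realType) (S A : finType) (m : mdp R S A)
    (h : 'rV[R]_#|A| -> \bar R) (pi : nat -> 'M[R]_(#|S|, #|A|))
    (eta err : nat -> R) :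
  dummy_states m <> setT ->
  mirror_map h ->
  (forall k, policies (pi k)) ->
  relint policies (pi 0%N) ->
  pmd_sequence m h eta pi ->
  nondecreasing_seq eta ->
  (forall k, 0 < eta k) ->
  (forall s a k, qvalue m (pi k) s a - opt_qvalue m s a <= err k) ->
  nonincreasing_seq err ->
  err @ \oo --> 0 ->
  ((forall p, simplex p -> has_gradient h p) ->
     (stopping_index m h eta err < +oo)%E ->
     forall k : nat, (stopping_index m h eta err <= k%:R%:E)%E ->
     forall s, opt_policies_at m s (policy_at (pi k.+1) s) /\
               value m (pi k.+1) s = opt_value m s)
  /\
  ((forall p, (closure (@simplex R #|A|) `\` relint (@simplex R #|A|)) p ->
      subdifferential h p = set0) ->
     forall k : nat,
     (forall s, relint (@simplex R #|A|) (policy_at (pi k.+1) s)) /\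
     (forall s a b, ~ dummy_states m s ->
        ~ opt_actions m s a -> opt_actions m s b ->
        acoord (gradient h (policy_at (pi k.+1) s)) a
          - acoord (gradient h (policy_at (pi k.+1) s)) b
        <= acoord (gradient h (policy_at (pi 0%N) s)) a
           - acoord (gradient h (policy_at (pi 0%N) s)) b
           - (\sum_(0 <= i < k.+1) eta i * advantage_gap m
              - \sum_(0 <= i < k.+1) eta i * err i))).
Proof.
move=> _ hmirror pi_policies _ pmd eta_nd eta_gt0 err_bound err_ni _; split.
  move=> hgrad _ k le_k s.
  have [a0 _] : exists a : A, True.
    case: (pi_policies 0%N s) => p1 _; apply: contrapT => noA.
    have : \sum_i policy_at (pi 0%N) s 0 i = 0.
      by apply: big1 => i _; case: noA; exists (enum_val i).
    by rewrite p1 => /eqP; rewrite oner_eq0.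
  have opt := pmd_optimal pi_policies pmd eta_gt0 err_bound hgrad
    (stopping_index_le a0 eta_nd eta_gt0 err_ni le_k).
  by split; [exists (pi k.+1) | case: opt => _ ->].
move=> no_subgradient k.
have ri i s := pmd_relint hmirror pi_policies pmd i s no_subgradient.
split=> // s a b sd aopt bopt.
exact: (pmd_gradient_sum hmirror pi_policies pmd eta_gt0 err_bound k.+1 sd aopt
  bopt (fun i => ri i s)).
Qed.
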